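(* Assume that the semigroup $(T_t)_{t\ge0}$ is generated by the simple operator $L=Id-\mathbb{E}$ on a finite probability space, or by a tensor of such simple operators on a product of finite probability spaces (as described in the context). Then it satisfies the $r$-logSob inequality with constant $4$ for all $r\in[0,1]$.
   Context: Setting: $(\Omega,\mu)$ is a finite probability space with $\mu\{\omega\}>0$ for all $\omega$; $\mathbb{E}f=\int_\Omega f\,d\mu$; $\mathcal{H}$ is the space of real-valued functions on $\Omega$ and $\mathcal{H}_{(0,\infty)}$ the set of strictly positive functions. For a generator $L:\mathcal{H}\to\mathcal{H}$, $T_t=e^{-tL}$ and the Dirichlet form is $\mathcal{E}(f,g)=\mathbb{E}[fLg]$. Simple generator: $L=Id-\mathbb{E}$, i.e. $Lf=f-\mathbb{E}f$. Tensor of simple operators: given finite probability spaces $(\Omega_i,\mu_i)$, $1\le i\le n$ (all atoms of positive mass), with simple generators $L_i=Id-\mathbb{E}_{\mu_i}$, one takes $(\Omega,\mu)=(\prod_i\Omega_i,\bigotimes_i\mu_i)$ and $L=\sum_{i=1}^n Id\otimes\cdots\otimes Id\otimes L_i\otimes Id\otimes\cdots\otimes Id$ ($L_i$ acting on the $i$-th coordinate), equivalently $T_t=\bigotimes_{i=1}^n e^{-tL_i}$. Write $\mathrm{Var}(f)=\mathbb{E}f^2-(\mathbb{E}f)^2$ and, for $f>0$, $Ent(f)=\mathbb{E}(f\log f)-\mathbb{E}f\cdot\log\mathbb{E}f$. Log-Sobolev inequalities: $p$-logSob is satisfied with constant $C>0$ if for every $f\in\mathcal{H}_{(0,\infty)}$: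 - for $p\in\mathbb{R}\setminus\{0,1\}$: $Ent(f^p)\le \frac{Cp^2}{4(p-1)}\mathcal{E}(f^{p-1},f)$; - for $p=1$: $Ent(f)\le\frac{C}{4}\mathcal{E}(f,\log f)$; - for $p=0$: $\mathrm{Var}(\log f)\le-\frac{C}{2}\mathcal{E}(f,1/f)$. *)

(* Defs.v *)
From HB Require Import structures.
From mathcomp Require Import all_boot all_order all_algebra.
From mathcomp Require Import reals exp.

Set Implicit Arguments.
Unset Strict Implicit.
Unset Printing Implicit Defensive.

Import Order.TTheory GRing.Theory Num.Theory.

Local Open Scope ring_scope.

Record finProbSpace (R : realType) := FinProbSpace {
  points :> finType;
  mass : points -> R;
  mass_gt0 : forall w, 0 < mass w;
  mass_sum1 : \sum_w mass w = 1 }.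

Section FiniteProbability.
Context {R : realType} (O : finProbSpace R).
Implicit Types (f g : O -> R) (L : (O -> R) -> O -> R).

Definition expect f : R := \sum_w mass w * f w.

Definition variance f : R := expect (fun w => f w ^+ 2) - expect f ^+ 2.

(* Only meaningful for f > 0: [ln] takes junk values on nonpositive reals. *)
Definition entropy f : R :=
  expect (fun w => f w * ln (f w)) - expect f * ln (expect f).

Definition dirichlet L f g : R := expect (fun w => f w * L g w).

Definition logSob L (p C : R) : Prop :=
  0 < C /\
  forall f, (forall w, 0 < f w) ->
    if p == 0 then
      variance (fun w => ln (f w)) <= - (C / 2) * dirichlet L f (fun w => (f w)^-1)
    else if p == 1 then
      entropy f <= C / 4 * dirichlet L f (fun w => ln (f w))
    else
      entropy (fun w => f w `^ p) <=
        C * p ^+ 2 / (4 * (p - 1)) * dirichlet L (fun w => f w `^ (p - 1)) f.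

Definition simple_gen f : O -> R := fun w => f w - expect f.

End FiniteProbability.

Section Product.
Context {R : realType} (n : nat) (O : 'I_n -> finProbSpace R).

Definition prod_points : finType := {dffun forall i : 'I_n, O i}.

Definition prod_mass (w : prod_points) : R := \prod_(i < n) mass (w i).

Lemma prod_mass_gt0 w : 0 < prod_mass w.
Proof. by apply: prodr_gt0 => i _; exact: mass_gt0. Qed.

Lemma prod_mass_sum1 : \sum_w prod_mass w = 1.
Proof.
rewrite /prod_mass (reindex (@dffun_of_fprod _ (fun i => O i))); last first.
  exact/onW_bij/dffun_of_fprod_bij.
pose P i : {ffun O i -> R} := [ffun x => mass x].
transitivity (\sum_(t : fprod (fun i => O i)) \prod_(i in 'I_n) P i (t i)).
  by apply: eq_bigr => t _; apply: eq_bigr => i _; rewrite /P !ffunE.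
rewrite big_fprod -(bigA_distr_big_dep _ (fun i j => untag 0 (P i) j)).
rewrite big1 // => i _; rewrite -(mass_sum1 (O i)).
transitivity (\sum_x P i x); last by apply: eq_bigr => x _; rewrite ffunE.
by rewrite (big_tag (fun i (x : O i) => P i x)).
Qed.

Definition prodSpace : finProbSpace R := FinProbSpace prod_mass_gt0 prod_mass_sum1.

Definition update (w : prod_points) (i : 'I_n) (x : O i) : prod_points :=
  [ffun j => dfwith w x j].

(* Id (x) ... (x) A (x) ... (x) Id with the operator A in position i: A is
   applied to the i-th partial function of f, the other coordinates being
   frozen. *)
Definition act_on (i : 'I_n) (A : (O i -> R) -> O i -> R)
    (f : prodSpace -> R) : prodSpace -> R :=
  fun w => A (fun x => f (update w x)) (w i).

Definition tensor_gen (f : prodSpace -> R) : prodSpace -> R :=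
  fun w => \sum_(i < n) act_on (@simple_gen R (O i)) f w.

End Product.

(* Main.v *)
Require Import Defs.
From HB Require Import structures.
From mathcomp Require Import all_boot all_order all_algebra.
From mathcomp Require Import classical_sets topology normedtype sequences derive.
From mathcomp Require Import boolp functions realfun.
From mathcomp Require Import reals exp.
From mathcomp Require Import ring lra.

Set Implicit Arguments.
Unset Strict Implicit.
Unset Printing Implicit Defensive.

Import Order.TTheory GRing.Theory Num.Theory.
Import numFieldNormedType.Exports.

Local Open Scope ring_scope.

(** The constant 4 comes from a one-coordinate inequality, which then passes
to products because entropy and variance are subadditive over independent
coordinates.

One coordinate. For L = Id - E one has E(f, g) = E[fg] - (E f)(E g), and
duplicating the variable,
  2 E(f, g) = E_x E_y [(f x - f y)(g x - g y)].
Jensen's inequality E ln g <= ln (E g) is exactly Ent(g) <= E(g, ln g), the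
case r = 1 ([entropy_le_dirichlet]). For 0 < r < 1 this is applied to g = f^r,
and E(f^r, ln f^r) is compared with r^2 / (r - 1) E(f^(r - 1), f) integrand by
integrand: with a = f x and b = f y one needs the two-point inequality
[powR_two_point]. For r = 0 the variance of ln f is E(ln f, ln f), compared
with - E(f, 1/f) by [ln_two_point]. In terms of v = (ln a - ln b) / 2 both
two-point inequalities are statements on sinh and follow from sinh v >= v and
sinh (r v) <= r sinh v.

Products. Both entropy and variance have the form
Phi(f) = E[phi(f)] - phi(E f), with phi(x) = x ln x or phi(x) = x^2, and both
are suprema of affine functionals of f ([above_tangents]); hence they are convex,
and averaging f over one coordinate does not increase the mean
Phi-entropy in another ([mean_phi_entropy_cond_expect]). Averaging the
coordinates out one after the other and telescoping gives
Phi(f) <= sum_i E[Phi_i(f)] ([phi_entropy_subadditive]). Since the Dirichlet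
form of the product is also the sum of the mean one-coordinate forms
([dirichlet_tensor]), every logSob inequality of the factors tensorizes with the
same constant ([tensor_logSob]). *)

(** * Two-point inequalities *)

Section TwoPoint.
Context {R : realType}.
Implicit Types (a b r u v x : R).

Lemma is_derive_ge0_le (f df : R -> R) x :
  (forall y, is_derive y (1 : R) f (df y)) -> (forall y, 0 <= y -> 0 <= df y) ->
  0 <= x -> f 0 <= f x.
Proof.
move=> fE df0 x0.
have fd y : derivable f y 1 by case: (fE y).
have H y : y \in `]0, x[ -> 0 <= f^`()%classic y.
  rewrite in_itv /= => /andP[y0 _]; rewrite derive1E.
  by have -> := @derive_val _ _ _ _ _ _ _ (fE y); apply/df0/ltW.
apply: (ger0_derive1_le_cc _ H) => //.
- apply: continuous_subspaceT => y; apply/differentiable_continuous.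
  exact/derivable1_diffP.
- by rewrite in_itv /= lexx.
- by rewrite in_itv /= x0 lexx.
Qed.

(** The factor 2 avoids divisions. *)
Definition twosinh v := expR v - expR (- v).

Lemma is_derive_expRM r v :
  is_derive v (1 : R) (fun x => expR (r * x)) (r * expR (r * v)).
Proof.
have -> : r * expR (r * v) = expR (r * v) * (r * 1) by ring.
apply: (@is_derive1_comp _ expR (fun x => r * x)).
Qed.

Lemma is_derive_twosinhM r v : is_derive v (1 : R) (fun x => twosinh (r * x))
  (r * (expR (r * v) + expR (- (r * v)))).
Proof.
have -> : (fun x => twosinh (r * x)) =
    (fun x => expR (r * x)) - (fun x => expR (- r * x)) :> (R -> R).
  by apply/funext => x; rewrite /twosinh -mulNr.
have -> : r * (expR (r * v) + expR (- (r * v))) =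
    r * expR (r * v) - - r * expR (- r * v) by rewrite -mulNr; ring.
by apply: is_deriveB; apply: is_derive_expRM.
Qed.

Lemma twosinhN v : twosinh (- v) = - twosinh v.
Proof. by rewrite /twosinh opprK opprB. Qed.

Lemma expR_addN_ge2 v : 2 <= expR v + expR (- v).
Proof.
have : 0 <= (expR (v / 2) - expR (- (v / 2))) ^+ 2 by exact: sqr_ge0.
have e0 := expR_gt0 (v / 2).
have -> : (expR (v / 2) - expR (- (v / 2))) ^+ 2 =
    expR (v / 2) * expR (v / 2) + expR (- (v / 2)) * expR (- (v / 2)) - 2.
  by rewrite !expRN; field; rewrite gt_eqF.
by rewrite -!expRD -opprD -splitr subr_ge0.
Qed.

Lemma twosinh_ge v : 0 <= v -> 2 * v <= twosinh v.
Proof.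
pose f x := twosinh (1 * x) - 2 * x.
move=> v0; suff : f 0 <= f v.
  by rewrite /f !mul1r mulr0 subr0 {1}/twosinh oppr0 subrr subr_ge0.
apply: (@is_derive_ge0_le f (fun y =>
  1 * (expR (1 * y) + expR (- (1 * y))) - 2 * 1)) => //.
  move=> y; apply: is_deriveB; first exact: is_derive_twosinhM.
by move=> y _; rewrite !mul1r mulr1 subr_ge0 expR_addN_ge2.
Qed.

(** Convexity of sinh on the half-line, read between 0 and v. On derivatives
it says cosh (r y) <= cosh y, visible from the factorization
cosh y - cosh (r y) = (e^y - e^(r y)) (1 - e^(-(y + r y))) / 2. *)
Lemma twosinh_scale r v : 0 <= r <= 1 -> 0 <= v ->
  twosinh (r * v) <= r * twosinh v.
Proof.
move=> /andP[r0 r1] v0.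
pose f x := r * twosinh (1 * x) - twosinh (r * x).
suff : f 0 <= f v.
  by rewrite /f !mulr0 mul1r {1 2}/twosinh oppr0 subrr mulr0 subr0 subr_ge0.
apply: (@is_derive_ge0_le f (fun y =>
  r * (1 * (expR (1 * y) + expR (- (1 * y))))
  - r * (expR (r * y) + expR (- (r * y))))) => //.
  move=> y; apply: is_deriveB; last exact: is_derive_twosinhM.
  apply: (@is_deriveZ _ _ _ (fun x => twosinh (1 * x)) r y 1).
  exact: is_derive_twosinhM.
move=> y y0; rewrite !mul1r -mulrBr mulr_ge0//.
have -> : expR y + expR (- y) - (expR (r * y) + expR (- (r * y))) =
    (expR y - expR (r * y)) * (1 - expR (- (y + r * y))).
  rewrite !expRN expRD; field.
  by rewrite !gt_eqF ?expR_gt0.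
apply: mulr_ge0; rewrite subr_ge0.
  by rewrite ler_expR ler_piMl.
by rewrite expR_le1 oppr_le0 addr_ge0// mulr_ge0.
Qed.

(** Factoring out the exponential of the midpoint makes every difference of
powers of a = e^s and b = e^t a multiple of a sinh of (s - t) / 2; the
midpoint factors on the two sides of a homogeneous inequality cancel. *)
Lemma expRB_twosinh q s t :
  expR (q * s) - expR (q * t) =
  expR (q * ((s + t) / 2)) * twosinh (q * ((s - t) / 2)).
Proof.
by rewrite /twosinh mulrBr -!expRD; congr (expR _ - expR _); field.
Qed.

(** After the substitution a = e^s, b = e^t, v = (s - t) / 2 and cancellation
of the midpoint exponentials, this reads
(1 - r) v sinh (r v) <= r sinh ((1 - r) v) sinh v for v >= 0, the product of
sinh (r v) <= r sinh v and (1 - r) v <= sinh ((1 - r) v). *)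
Lemma powR_two_point r a b : 0 < r < 1 -> 0 < a -> 0 < b ->
  (a `^ r - b `^ r) * (ln (a `^ r) - ln (b `^ r)) <=
  r ^+ 2 / (r - 1) * ((a `^ (r - 1) - b `^ (r - 1)) * (a - b)).
Proof.
move=> /andP[r0 r1].
wlog ba : a b / b <= a => [H a0 b0|].
  have [/H->//|/ltW ab] := leP b a.
  rewrite -[leLHS]mulrNN -[X in _ <= _ * X]mulrNN !opprB.
  exact: H.
move=> a0 b0.
rewrite !ln_powR -[in leRHS](lnK a0) -[in leRHS](lnK b0) -[in leLHS](lnK a0).
rewrite -[in leLHS](lnK b0) !expRK -!expRM.
have := ba; rewrite -ler_ln//.
move: (ln a) (ln b) => s t ts.
rewrite ![_ * r]mulrC ![_ * (r - 1)]mulrC.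
have -> : expR s - expR t = expR (1 * s) - expR (1 * t) by rewrite !mul1r.
rewrite !expRB_twosinh mul1r.
have v0 : 0 <= (s - t) / 2 by rewrite divr_ge0// subr_ge0.
set m := (s + t) / 2.
have -> : r * s - r * t = r * (2 * ((s - t) / 2)) by field.
move: v0; move: ((s - t) / 2) => v v0; rewrite mul1r.
have -> : expR (r * m) = expR ((r - 1) * m) * expR m.
  by rewrite -expRD; congr expR; ring.
have -> : (r - 1) * v = - ((1 - r) * v) by ring.
rewrite twosinhN.
have -> : r ^+ 2 / (r - 1) * (expR ((r - 1) * m) * - twosinh ((1 - r) * v)
     * (expR m * twosinh v)) =
  expR ((r - 1) * m) * expR m *
    (r * ((r * twosinh v) * (twosinh ((1 - r) * v) / (1 - r)))).
  by field; rewrite !subr_eq0 (gt_eqF r1) (lt_eqF r1).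
rewrite -!mulrA ler_pM2l ?expR_gt0// ler_pM2l ?expR_gt0// mulrCA ler_pM2l//.
have S0 x : 0 <= x -> 0 <= twosinh x.
  by move=> x0; apply: le_trans (twosinh_ge x0); rewrite mulr_ge0.
rewrite [leRHS]mulrA; apply: ler_pM.
- by rewrite S0// mulr_ge0// ltW.
- by rewrite mulr_ge0.
- by rewrite twosinh_scale// !ltW.
rewrite ler_pdivlMr ?subr_gt0//.
have := @twosinh_ge ((1 - r) * v).
rewrite mulr_ge0 ?subr_ge0 ?(ltW r1)// => /(_ isT).
by rewrite mulrAC mulrA [2 * _]mulrC -mulrA.
Qed.

(** The limit r -> 0 of the previous inequality divided by r^2; in the same
variables it is the square of v <= sinh v. *)
Lemma ln_two_point a b : 0 < a -> 0 < b ->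
  (ln a - ln b) * (ln a - ln b) <= - 1 * ((a - b) * (a^-1 - b^-1)).
Proof.
wlog ba : a b / b <= a => [H a0 b0|].
  have [/H->//|/ltW ab] := leP b a.
  rewrite -[leLHS]mulrNN -[X in _ <= _ * X]mulrNN !opprB.
  exact: H.
move=> a0 b0.
rewrite -[in leRHS](lnK a0) -[in leRHS](lnK b0) -!expRN.
have := ba; rewrite -ler_ln//.
move: (ln a) (ln b) => s t ts.
have -> : expR s - expR t = expR (1 * s) - expR (1 * t) by rewrite !mul1r.
have -> : expR (- s) - expR (- t) = expR (-1 * s) - expR (-1 * t).
  by rewrite !mulN1r.
rewrite !expRB_twosinh !mul1r.
have v0 : 0 <= (s - t) / 2 by rewrite divr_ge0// subr_ge0.
have vE : s - t = 2 * ((s - t) / 2) by field.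
have -> : (s - t) * (s - t) = 2 * ((s - t) / 2) * (2 * ((s - t) / 2)).
  by rewrite -vE.
move: v0 {vE}; move: ((s - t) / 2) => v v0.
rewrite !mulN1r twosinhN expRN.
set m := expR _.
have -> : - (m * twosinh v * (m^-1 * - twosinh v)) = twosinh v * twosinh v.
  by field; rewrite gt_eqF// expR_gt0.
by apply: ler_pM; rewrite ?twosinh_ge ?mulr_ge0.
Qed.

End TwoPoint.

(** * Expectations and the simple generator *)

Section Expectation.
Context {R : realType}.
Implicit Types O : finProbSpace R.

Lemma eq_expect O (f g : O -> R) : f =1 g -> expect f = expect g.
Proof. by move=> fg; apply: eq_bigr => w _; rewrite fg. Qed.

Lemma expectD O (f g : O -> R) :
  expect (fun w => f w + g w) = expect f + expect g.
Proof. by rewrite /expect -big_split; apply: eq_bigr => w _; rewrite mulrDr. Qed.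

Lemma expectZ O c (f : O -> R) : expect (fun w => c * f w) = c * expect f.
Proof. by rewrite /expect mulr_sumr; apply: eq_bigr => w _; rewrite mulrCA. Qed.

Lemma expectB O (f g : O -> R) :
  expect (fun w => f w - g w) = expect f - expect g.
Proof.
rewrite -[- expect g]mulN1r -expectZ -expectD.
by apply: eq_expect => w; rewrite mulN1r.
Qed.

Lemma expect_cst O c : expect (fun _ : O => c) = c.
Proof. by rewrite /expect -mulr_suml mass_sum1 mul1r. Qed.

Lemma expect_sum O I (s : seq I) (F : I -> O -> R) :
  expect (fun w => \sum_(i <- s) F i w) = \sum_(i <- s) expect (F i).
Proof.
by rewrite /expect exchange_big; apply: eq_bigr => w _; rewrite mulr_sumr.
Qed.

Lemma le_expect O (f g : O -> R) :
  (forall w, f w <= g w) -> expect f <= expect g.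
Proof.
by move=> fg; apply: ler_sum => w _; rewrite ler_wpM2l// ltW// mass_gt0.
Qed.

Lemma expect_ge0 O (f : O -> R) : (forall w, 0 <= f w) -> 0 <= expect f.
Proof. by move=> f0; apply: sumr_ge0 => w _; rewrite mulr_ge0// ltW// mass_gt0. Qed.

Lemma expect_gt0 O (f : O -> R) : (forall w, 0 < f w) -> 0 < expect f.
Proof.
move=> f0; have fw w : 0 < mass w * f w by rewrite mulr_gt0// mass_gt0.
rewrite lt_def sumr_ge0 ?andbT => [|w _]; last exact: ltW.
apply: contra_eq_neq (mass_sum1 O) => /eqP.
rewrite psumr_eq0 => [/allP H|w _]; last exact: ltW.
rewrite big1 ?(eq_sym 0) ?oner_eq0// => w _.
by have := H w (mem_index_enum w); rewrite gt_eqF.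
Qed.

Lemma exchange_expect O (P : finProbSpace R) (F : O -> P -> R) :
  expect (fun x => expect (F x)) = expect (fun y => expect (fun x => F x y)).
Proof.
rewrite /expect; under eq_bigr do rewrite mulr_sumr.
rewrite exchange_big; apply: eq_bigr => y _; rewrite mulr_sumr.
by apply: eq_bigr => x _; rewrite mulrCA.
Qed.

Lemma dirichlet_simpleE O (f g : O -> R) :
  dirichlet (@simple_gen R O) f g = expect (fun w => f w * g w) - expect f * expect g.
Proof.
rewrite /dirichlet /simple_gen [expect f * _]mulrC -expectZ -expectB.
by apply: eq_expect => w; ring.
Qed.

(** The right-hand side only sees pairs of values, which reduces inequalities
between Dirichlet forms to two-point inequalities. *)
Lemma dirichlet_simple_sym O (f g : O -> R) :
  2 * dirichlet (@simple_gen R O) f g =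
  expect (fun x => expect (fun y => (f x - f y) * (g x - g y))).
Proof.
rewrite dirichlet_simpleE.
transitivity (expect (fun x => f x * g x + expect (fun y => f y * g y)
    - (expect g * f x + expect f * g x))).
  by rewrite expectB !expectD !expectZ expect_cst; ring.
apply: eq_expect => x; symmetry.
transitivity (expect (fun y => (f x * g x + f y * g y) - (f x * g y + g x * f y))).
  by apply: eq_expect => y; ring.
by rewrite expectB !expectD !expectZ expect_cst; ring.
Qed.

Lemma le_dirichlet_simple O (f g f' g' : O -> R) c :
  (forall x y, (f x - f y) * (g x - g y) <= c * ((f' x - f' y) * (g' x - g' y))) ->
  dirichlet (@simple_gen R O) f g <= c * dirichlet (@simple_gen R O) f' g'.
Proof.
move=> H; rewrite -(ler_pM2l (ltr0n R 2)) mulrCA !dirichlet_simple_sym -expectZ.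
by apply: le_expect => x; rewrite -expectZ; apply: le_expect => y.
Qed.

Lemma variance_dirichlet O (f : O -> R) :
  variance f = dirichlet (@simple_gen R O) f f.
Proof. by rewrite dirichlet_simpleE -expr2. Qed.

Lemma variance_ge0 O (f : O -> R) : 0 <= variance f.
Proof.
rewrite variance_dirichlet -(pmulr_rge0 _ (ltr0n R 2)) dirichlet_simple_sym.
by apply: expect_ge0 => x; apply: expect_ge0 => y; rewrite -expr2 sqr_ge0.
Qed.

Lemma ln_le_tangent (x y : R) : 0 < x -> 0 < y -> ln x <= ln y + (x / y - 1).
Proof.
move=> x0 y0; rewrite -lerBlDl -ln_div//.
by have := @le_ln1Dx R (x / y - 1); rewrite subrKC ltrBrDl subrr divr_gt0//; apply.
Qed.

Lemma expect_ln_le O (f : O -> R) : (forall w, 0 < f w) ->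
  expect (fun w => ln (f w)) <= ln (expect f).
Proof.
move=> f0; have E0 := expect_gt0 f0.
apply: (@le_trans _ _ (expect (fun w => ln (expect f) - 1 + (expect f)^-1 * f w))).
  apply: le_expect => w; apply: le_trans (ln_le_tangent (f0 w) E0) _.
  by rewrite mulrC addrA addrAC.
by rewrite expectD expect_cst expectZ mulVf ?gt_eqF// subrK.
Qed.

(** Both sides contain E[f ln f]; what remains is Jensen's inequality for ln
multiplied by E f. *)
Lemma entropy_le_dirichlet O (f : O -> R) : (forall w, 0 < f w) ->
  entropy f <= dirichlet (@simple_gen R O) f (fun w => ln (f w)).
Proof.
move=> f0; rewrite dirichlet_simpleE /entropy lerD2l lerN2.
by rewrite ler_pM2l ?expect_gt0// expect_ln_le.
Qed.

(** For r = 0 the comparison holds with factor 1 while the inequality allows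
factor 2, whence the appeal to the nonnegativity of the variance. *)
Lemma simple_logSob O r : 0 <= r <= 1 -> logSob (@simple_gen R O) r 4.
Proof.
move=> /andP[r0 r1]; split=> // f f0.
have four : 4 / 4 = 1 :> R by rewrite divff ?pnatr_eq0.
case: eqP => [_|/eqP rN0].
  have H : variance (fun w => ln (f w)) <=
      -1 * dirichlet (@simple_gen R O) f (fun w => (f w)^-1).
    by rewrite variance_dirichlet le_dirichlet_simple// => x y; apply: ln_two_point.
  have V0 := variance_ge0 (fun w => ln (f w)).
  by apply: le_trans (H) _; lra.
case: eqP => [_|/eqP rN1].
  by rewrite four mul1r entropy_le_dirichlet.
have fr w : 0 < f w `^ r by exact: powR_gt0.
apply: le_trans (entropy_le_dirichlet fr) _.
rewrite -mulf_div four mul1r.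
apply: le_dirichlet_simple => x y; apply: powR_two_point => //.
by rewrite !lt_def rN0 r0 r1 eq_sym rN1.
Qed.

End Expectation.

(** * Entropies attached to a function *)

Section PhiEntropy.
Context {R : realType}.
Implicit Types (O : finProbSpace R) (phi : R -> R) (D : R -> Prop).

(** With phi x = x ^+ 2 this unfolds to the variance, with phi x = x * ln x to
the entropy. *)
Definition phi_entropy phi O (f : O -> R) : R :=
  expect (fun w => phi (f w)) - phi (expect f).

Definition mean_closed D : Prop :=
  forall O (f : O -> R), (forall w, D (f w)) -> D (expect f).

(** If phi' is the derivative of phi, the left-hand side is the first-order
expansion at h of the phi-entropy, so this is its convexity, in the form of a
variational formula by affine functionals. It is stronger than convexity of phi. *)
Definition above_tangents D phi phi' : Prop :=
  forall O (f h : O -> R), (forall w, D (f w)) -> (forall w, D (h w)) ->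
  phi_entropy phi h
    + expect (fun w => (phi' (h w) - phi' (expect h)) * (f w - h w))
  <= phi_entropy phi f.

(** The gap between the two sides is the variance of f - h. *)
Lemma sqr_above_tangents :
  above_tangents (fun=> True) (fun x => x ^+ 2) (fun x => 2 * x).
Proof.
move=> O f h _ _; rewrite /phi_entropy.
have -> : expect (fun w => (2 * h w - 2 * expect h) * (f w - h w)) =
    expect (fun w => f w ^+ 2) - expect (fun w => h w ^+ 2)
    - expect (fun w => (f w - h w) ^+ 2) - 2 * expect h * expect (fun w => f w - h w).
  rewrite -(expectZ (2 * expect h)) -!expectB; apply: eq_expect => w; ring.
have := variance_ge0 (fun w => f w - h w).
rewrite /variance expectB; nra.
Qed.

(** The constant terms cancel and leave
E[f (ln h - ln (E h))] <= E[f (ln f - ln (E f))], the nonnegativity of the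
relative entropy of f with respect to h. *)
Lemma xlnx_above_tangents :
  above_tangents (fun x => 0 < x) (fun x => x * ln x) (@ln R).
Proof.
move=> O f h f0 h0; rewrite /phi_entropy.
have F0 := expect_gt0 f0; have H0 := expect_gt0 h0.
have -> : expect (fun w => (ln (h w) - ln (expect h)) * (f w - h w)) =
    expect (fun w => f w * ln (h w)) - ln (expect h) * expect f
    - expect (fun w => h w * ln (h w)) + ln (expect h) * expect h.
  rewrite -!expectZ -!expectB -expectD; apply: eq_expect => w; ring.
suff : expect (fun w => f w * ln (h w)) - ln (expect h) * expect f <=
    expect (fun w => f w * ln (f w)) - expect f * ln (expect f) by lra.
have -> : expect (fun w => f w * ln (h w)) - ln (expect h) * expect f =
    expect (fun w => f w * ln (h w) + (ln (expect f) - ln (expect h)) * f w)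
    - expect f * ln (expect f).
  by rewrite expectD expectZ; ring.
rewrite lerD2r.
have -> : expect (fun w => f w * ln (f w)) =
    expect (fun w => f w * ln (f w) + (expect f / expect h * h w - f w)).
  by rewrite expectD expectB expectZ divfK ?gt_eqF// subrr addr0.
apply: le_expect => w; have fw := f0 w.
have -> : f w * ln (f w) + (expect f / expect h * h w - f w) =
    f w * (ln (f w) + (h w * (expect f / expect h) / f w - 1)).
  by field; rewrite !gt_eqF.
have -> : f w * ln (h w) + (ln (expect f) - ln (expect h)) * f w =
    f w * ln (h w * (expect f / expect h)).
  by rewrite lnM ?posrE ?divr_gt0// ln_div//; ring.
by rewrite ler_pM2l// ln_le_tangent// mulr_gt0// divr_gt0.
Qed.

(** Jensen's inequality for the phi-entropy: average over y the tangent bounds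
at the mean h; their linear parts average to zero. *)
Lemma phi_entropy_expect D phi phi' O (P : finProbSpace R) (F : P -> O -> R) :
  mean_closed D -> above_tangents D phi phi' -> (forall y x, D (F y x)) ->
  phi_entropy phi (fun x => expect (fun y => F y x)) <=
  expect (fun y => phi_entropy phi (F y)).
Proof.
move=> cD tphi DF; set h := fun x => _.
have Dh x : D (h x) by apply: cD => y; exact: DF.
pose k x := phi' (h x) - phi' (expect h).
apply: (@le_trans _ _ (expect (fun y : P =>
    phi_entropy phi h + expect (fun x => k x * (F y x - h x))))); last first.
  by apply: le_expect => y; apply: tphi.
rewrite expectD expect_cst exchange_expect.
rewrite (_ : expect _ = 0) ?addr0// -[RHS](expect_cst O).
by apply: eq_expect => x; rewrite expectZ expectB expect_cst subrr mulr0.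
Qed.

End PhiEntropy.

(** * Tensorization *)

Section Tensorization.
Context {R : realType} (n : nat) (O : 'I_n -> finProbSpace R).
Implicit Types (w : prod_points O) (f g : prodSpace O -> R) (s : seq 'I_n).

Lemma update_same w i (x : O i) : update w x i = x.
Proof. by rewrite ffunE dfwith_in. Qed.

Lemma update_out w i (x : O i) j : i != j -> update w x j = w j.
Proof. by move=> ij; rewrite ffunE dfwith_out. Qed.

Lemma update_id w i : update w (w i) = w.
Proof. by apply/ffunP => j; rewrite ffunE; case: dfwithP. Qed.

Lemma update_update w i (x y : O i) : update (update w x) y = update w y.
Proof.
apply/ffunP => j; have [<-|ij] := eqVneq i j; first by rewrite !update_same.
by rewrite !update_out.
Qed.

Lemma updateC w i j (x : O i) (y : O j) : i != j ->
  update (update w x) y = update (update w y) x.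
Proof.
move=> ij; apply/ffunP => k.
have [<-|ik] := eqVneq i k.
  by rewrite update_same update_out 1?eq_sym// update_same.
have [<-|jk] := eqVneq j k.
  by rewrite update_same update_out// update_same.
by rewrite !update_out.
Qed.

Definition section_at i f w : O i -> R := fun x => f (update w x).

Arguments section_at i f w x : clear implicits.

Definition cond_expect i f : prodSpace O -> R :=
  fun w => expect (section_at i f w).

Lemma prod_mass_update w i (x : O i) :
  prod_mass (update w x) * mass (w i) = prod_mass w * mass x.
Proof.
rewrite /prod_mass [in LHS](bigD1 i)//= [in RHS](bigD1 i)//= update_same.
rewrite mulrAC [mass x * _]mulrC -!mulrA; congr (_ * _); rewrite mulrC.
by congr (_ * _); apply: eq_bigr => j ji; rewrite update_out// eq_sym.
Qed.

(** Exchanging the i-th coordinate of w with the fresh value x is an involution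
of the pairs (w, x) which preserves the product of the masses
([prod_mass_update]). *)
Lemma expect_cond_expect i f : expect (cond_expect i f) = expect f.
Proof.
rewrite /expect /cond_expect /expect.
under eq_bigr do rewrite mulr_sumr.
rewrite pair_big /=.
pose swap (p : prod_points O * O i) := (update p.1 p.2, p.1 i).
have swapK : involutive swap.
  by case=> w x; rewrite /swap /= update_same update_update update_id.
rewrite (reindex swap) /=; last exact/onW_bij/inv_bij.
transitivity (\sum_(p : prod_points O * O i) prod_mass p.1 * (mass p.2 * f p.1)).
  apply: eq_bigr => -[w x] _ /=.
  by rewrite /section_at update_update update_id !mulrA prod_mass_update.
rewrite -(pair_big xpredT xpredT (fun w x => prod_mass w * (mass x * f w))) /=.
apply: eq_bigr => w _; rewrite -mulr_sumr -mulr_suml.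
by rewrite mass_sum1 mul1r.
Qed.

(** Averaging the i-th term over coordinate i does not change its expectation
and turns it into the Dirichlet form of the i-th factor. *)
Lemma dirichlet_tensor f g :
  dirichlet (@tensor_gen R n O) f g =
  \sum_(i < n) expect (fun w : prodSpace O =>
     dirichlet (@simple_gen R (O i)) (section_at i f w) (section_at i g w)).
Proof.
rewrite -expect_sum /dirichlet /tensor_gen.
transitivity (\sum_(i < n) expect (fun w : prodSpace O =>
    f w * act_on (@simple_gen R (O i)) g w)).
  by rewrite -expect_sum; apply: eq_expect => w; rewrite mulr_sumr.
rewrite expect_sum; apply: eq_bigr => i _.
rewrite -(expect_cond_expect i).
apply: eq_expect => w; apply: eq_expect => x.
rewrite /section_at /act_on update_same; congr (_ * _); rewrite /simple_gen.
rewrite update_update; congr (_ - _).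
by apply: eq_expect => y; rewrite update_update.
Qed.

Variables (D : R -> Prop) (phi phi' : R -> R).
Hypotheses (cD : mean_closed D) (tphi : above_tangents D phi phi').

Definition mean_phi_entropy i f : R :=
  expect (fun w : prodSpace O => phi_entropy phi (section_at i f w)).

(** Averages over distinct coordinates commute, so the i-section of the
average over j is a mixture of i-sections of f, and convexity of the
phi-entropy applies. *)
Lemma mean_phi_entropy_cond_expect i j f : i != j -> (forall w, D (f w)) ->
  mean_phi_entropy i (cond_expect j f) <= mean_phi_entropy i f.
Proof.
move=> ij Df.
rewrite /mean_phi_entropy.
rewrite -[leRHS](expect_cond_expect j).
apply: le_expect => w; rewrite /cond_expect /section_at.
have /(phi_entropy_expect cD tphi) : forall (y : O j) (x : O i),
  D (f (update (update w y) x)) by [].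
apply: le_trans.
suff -> : (fun x => expect (fun y : O j => f (update (update w x) y))) =
  (fun x : O i => expect (fun y : O j => f (update (update w y) x))) by [].
by apply/funext => x; apply: eq_expect => y; rewrite updateC.
Qed.

Definition iter_cond_expect s f := foldr cond_expect f s.

Lemma iter_cond_expect_dom s f : (forall w, D (f w)) ->
  forall w, D (iter_cond_expect s f w).
Proof.
by move=> Df; elim: s => [|i s IH] //= w; apply: cD => x; exact: IH.
Qed.

Lemma mean_phi_entropy_iter i s f : i \notin s -> (forall w, D (f w)) ->
  mean_phi_entropy i (iter_cond_expect s f) <= mean_phi_entropy i f.
Proof.
move=> + Df; elim: s => [|j s IH] //=; rewrite inE negb_or => /andP[ij /IH].
apply: le_trans; apply: mean_phi_entropy_cond_expect => //.
exact: iter_cond_expect_dom.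
Qed.

(** The increment of the telescoping sum. *)
Lemma mean_phi_entropyE i f : mean_phi_entropy i f =
  expect (fun w : prodSpace O => phi (f w))
  - expect (fun w : prodSpace O => phi (cond_expect i f w)).
Proof.
rewrite /mean_phi_entropy /phi_entropy expectB; congr (_ - _).
exact: (expect_cond_expect i (fun w => phi (f w))).
Qed.

(** Each increment is the mean phi-entropy, in a coordinate not yet averaged
out, of a partially averaged function; hence at most that of f itself. *)
Lemma telescope_phi_entropy s f : uniq s -> (forall w, D (f w)) ->
  expect (fun w : prodSpace O => phi (f w))
  - expect (fun w : prodSpace O => phi (iter_cond_expect s f w))
  <= \sum_(i <- s) mean_phi_entropy i f.
Proof.
move=> + Df; elim: s => [|i s IH] /=; first by rewrite big_nil subrr.
move=> /andP[si /IH{}IH]; rewrite big_cons.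
have := mean_phi_entropy_iter si Df; rewrite mean_phi_entropyE.
lra.
Qed.

(** Coordinates that have been averaged out no longer matter; once all of them
are, the function is constant. *)
Lemma iter_cond_expect_local s f w w' :
  (forall i, i \notin s -> w i = w' i) ->
  iter_cond_expect s f w = iter_cond_expect s f w'.
Proof.
elim: s w w' => [|i s IH] w w' ww' /=.
  by congr f; apply/ffunP => i; apply: ww'.
apply: eq_expect => x; apply: IH => j js.
have [<-|ij] := eqVneq i j; first by rewrite !update_same.
by rewrite !update_out// ww'// inE negb_or eq_sym ij.
Qed.

Lemma iter_cond_expect_all f w :
  iter_cond_expect (enum 'I_n) f w = expect f.
Proof.
rewrite -[LHS](expect_cst (prodSpace O)).
transitivity (expect (iter_cond_expect (enum 'I_n) f)).
  by apply: eq_expect => w'; apply: iter_cond_expect_local => i; rewrite mem_enum.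
by elim: (enum _) => [|i s IH] //=; rewrite expect_cond_expect.
Qed.

(** The telescoping bound over all coordinates, where the last term is the
constant function with value expect f. *)
Lemma phi_entropy_subadditive f : (forall w, D (f w)) ->
  phi_entropy phi f <= \sum_(i < n) mean_phi_entropy i f.
Proof.
move=> Df; have := telescope_phi_entropy (enum_uniq 'I_n) Df.
rewrite big_enum /=; apply: le_trans; rewrite lerD2l lerN2.
by under eq_expect do rewrite iter_cond_expect_all; rewrite expect_cst.
Qed.

Lemma tensorize_phi_entropy f g h c : (forall w, D (f w)) ->
  (forall w i, phi_entropy phi (section_at i f w) <=
     c * dirichlet (@simple_gen R (O i)) (section_at i g w)
                                         (section_at i h w)) ->
  phi_entropy phi f <= c * dirichlet (@tensor_gen R n O) g h.
Proof.
move=> Df H; apply: le_trans (phi_entropy_subadditive Df) _.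
rewrite dirichlet_tensor mulr_sumr; apply: ler_sum => i _.
by rewrite -expectZ; apply: le_expect => w.
Qed.

End Tensorization.

Arguments section_at {R n O} i f w x.

Lemma tensor_logSob (R : realType) n (O : 'I_n -> finProbSpace R) p C : 0 < C ->
  (forall i, logSob (@simple_gen R (O i)) p C) -> logSob (@tensor_gen R n O) p C.
Proof.
move=> C0 H; split=> // f f0.
have Hi i w := (H i).2 (section_at i f w) (fun x => f0 _).
have posD : mean_closed (fun x : R => 0 < x) by move=> P g; exact: expect_gt0.
case: eqP Hi => [_|_] Hi.
  by apply: (tensorize_phi_entropy _ (@sqr_above_tangents R)) => // w i; exact: Hi.
case: eqP Hi => [_|_] Hi.
  by apply: (tensorize_phi_entropy posD (@xlnx_above_tangents R)) => // w i; exact: Hi.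
apply: (tensorize_phi_entropy posD (@xlnx_above_tangents R)).
  by move=> w; exact: powR_gt0.
by move=> w i; exact: Hi.
Qed.

Theorem corollary1p9 (R : realType) :
  (forall (O : finProbSpace R) (r : R), 0 <= r <= 1 ->
     logSob (@simple_gen R O) r 4) /\
  (forall (n : nat) (O : 'I_n -> finProbSpace R) (r : R), 0 <= r <= 1 ->
     logSob (@tensor_gen R n O) r 4).
Proof.
split=> [O r r01|n O r r01]; first exact: simple_logSob.
by apply: tensor_logSob => // i; apply: simple_logSob.
Qed.
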